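(* Let $\mathcal{H}$ be a separable Hilbert space, $K\in B(\mathcal{H})$, and let $F=\{f_i\}_{i\in I}$ be a Parseval $K$-frame for $\mathcal{H}$. Then for every $J\subseteq I$ and every $f\in\mathcal{H}$, $$\mathrm{Re}\left(\sum_{i\in J^c}\langle f,f_i\rangle\,\overline{\langle KK^*f,f_i\rangle}\right)+\left\Vert\sum_{i\in J}\langle f,f_i\rangle f_i\right\Vert^2=\mathrm{Re}\left(\sum_{i\in J}\langle f,f_i\rangle\,\overline{\langle KK^*f,f_i\rangle}\right)+\left\Vert\sum_{i\in J^c}\langle f,f_i\rangle f_i\right\Vert^2\ge\frac34\Vert KK^*f\Vert^2 .$$
   Context: $B(\mathcal{H})$ is the set of bounded linear operators on $\mathcal{H}$, $I$ is a countable index set, $J^c=I\setminus J$, and the inner product is linear in the first variable. A sequence $\{f_i\}_{i\in I}\subseteq\mathcal{H}$ is a Parseval $K$-frame for $\mathcal{H}$ if $\sum_{i\in I}|\langle f,f_i\rangle|^2=\Vert K^*f\Vert^2$ for all $f\in\mathcal{H}$. *)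

(* Defs.v *)
From HB Require Import structures.
From mathcomp Require Import all_boot all_order all_algebra.
From mathcomp Require Import complex finmap.
From mathcomp Require Import boolp classical_sets functions cardinality reals.
From mathcomp Require Import topology normedtype.

Set Implicit Arguments.
Unset Strict Implicit.
Unset Printing Implicit Defensive.

Import Order.TTheory GRing.Theory Num.Theory Num.Def.
Import numFieldNormedType.Exports.

Local Open Scope classical_set_scope.
Local Open Scope ring_scope.

(* Scalars are the complex numbers R[i] over R : realType.  In MathComp the
   norm of a normedModType R[i] takes its (real, nonnegative) values in R[i],
   and x <= y in R[i] means that y - x is real and nonnegative.  R[i] itself is
   viewed as a normed space over R[i] through its regular module R[i]^o. *)

(* A Hilbert space is a complete normed space whose norm is the one of an inner
   product.  A form [dot : {dot H for conjC}] is a positive definite hermitian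
   form that is linear in its first and conjugate-linear in its second
   argument. *)
Definition induces_norm (R : realType) (H : normedModType R[i])
    (dot : {dot H for conjC}) : Prop :=
  forall x : H, `|x| ^+ 2 = dot x x.

Definition separable_space (T : topologicalType) : Prop :=
  exists D : set T, countable D /\ dense D.

Definition bounded_operator (R : realType) (H : normedModType R[i])
    (K : {linear H -> H}) : Prop :=
  exists M : R[i], forall x : H, `|K x| <= M * `|x|.

(* [adjoint dot K y] is the vector z such that <K x, y> = <x, z> for all x; it
   is unique when it exists, and for a bounded operator on a Hilbert space it
   exists by the Riesz representation theorem. *)
Definition adjoint (R : realType) (H : normedModType R[i])
    (dot : {dot H for conjC}) (K : H -> H) (y : H) : H :=
  get [set z : H | forall x : H, dot (K x) y = dot x z].

(* The filter of the finite subsets of I directed by inclusion: sums over a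
   countable index set are unconditional, i.e. independent of any enumeration
   of the index set. *)
Definition finsets (I : choiceType) : set_system {fset I} :=
  filter_from [set: {fset I}] (fun A => [set B | (A `<=` B)%fset]).
Arguments finsets I : clear implicits.

(* For x : I -> V, the net of the finite partial sums of the x i, i in J. *)
Definition partial_sum (R : realType) (V : normedModType R[i])
    (I : choiceType) (J : set I) (x : I -> V) (A : {fset I}) : V :=
  \sum_(i <- A | i \in J) x i.

Definition has_sum (R : realType) (V : normedModType R[i])
    (I : choiceType) (J : set I) (x : I -> V) (s : V) : Prop :=
  partial_sum J x @ finsets I --> s.

Definition summable_over (R : realType) (V : normedModType R[i])
    (I : choiceType) (J : set I) (x : I -> V) : Prop :=
  exists s : V, has_sum J x s.

(* Meaningful only when [summable_over J x]. *)
Definition sum_over (R : realType) (V : normedModType R[i])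
    (I : choiceType) (J : set I) (x : I -> V) : V :=
  lim (partial_sum J x @ finsets I).

Definition parseval_K_frame (R : realType) (H : normedModType R[i])
    (dot : {dot H for conjC}) (K : H -> H) (I : countType) (F : I -> H) : Prop :=
  forall f : H,
    has_sum [set: I] (fun i => `|dot f (F i)| ^+ 2 : R[i]^o)
      (`|adjoint dot K f| ^+ 2).

(* Main.v *)
Require Import Defs.
From HB Require Import structures.
From mathcomp Require Import all_boot all_order all_algebra.
From mathcomp Require Import complex finmap.
From mathcomp Require Import boolp classical_sets functions cardinality reals.
From mathcomp Require Import topology normedtype.
From mathcomp Require Import ring lra.

Set Implicit Arguments.
Unset Strict Implicit.
Unset Printing Implicit Defensive.

Import Order.TTheory GRing.Theory Num.Theory Num.Def.
Import numFieldNormedType.Exports.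

Local Open Scope classical_set_scope.
Local Open Scope ring_scope.

(** Write [a] and [b] for the sums of [<f, F i> F i] over [J] and over its
complement.  Everything rests on the identity [a + b = K K^* f].  Once it is
known, continuity of the inner product turns the two scalar sums into
[<a, a + b>] and [<b, a + b>], so both sides of the claimed equality are
[|a|^2 + |b|^2 + Re <a, b>], and this exceeds [3/4 |a + b|^2] by exactly
[1/4 |a - b|^2].

The identity comes from polarization.  The frame operator
[S f = sum_i <f, F i> F i] satisfies
[<S f, f> = sum_i |<f, F i>|^2 = |K^* f|^2 = <K K^* f, f>], and over the complex
numbers a linear operator is determined by its quadratic form
([linear_numrange0]), whence [S = K K^*] ([frame_operatorE]).

Convergence of the vector sums, over any subset of the index set, is a Cauchy
argument: a finite partial sum [w] of them obeys
[|w|^2 <= C sum_i |<f, F i>|^2] with [C] a bound for [K^*]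
([synthesis_bounded]), and the right-hand side is a tail of a convergent series
of nonnegative terms.  Both steps use that [K^*] exists and is bounded, which is
the Riesz representation theorem ([riesz]); it is proved by minimizing
[|x|^2 - 2 Re phi(x)]. *)

(** * Inner product spaces *)

Section InnerProduct.
Variables (R : realType) (H : normedModType R[i]) (dot : {dot H for conjC}).
Hypothesis dotN : induces_norm dot.
Implicit Types (x y z : H) (a : R[i]).

Lemma dotDl x y z : dot (x + y) z = dot x z + dot y z.
Proof. by rewrite linearDl. Qed.

Lemma dotDr z x y : dot z (x + y) = dot z x + dot z y.
Proof. by rewrite linearDr. Qed.

Lemma dotBl x y z : dot (x - y) z = dot x z - dot y z.
Proof. by rewrite linearBl. Qed.

Lemma dotBr z x y : dot z (x - y) = dot z x - dot z y.
Proof. by rewrite linearBr. Qed.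

Lemma dotZl a x z : dot (a *: x) z = a * dot x z.
Proof. by rewrite linearZl_LR. Qed.

Lemma dotZr a x z : dot z (a *: x) = conjC a * dot z x.
Proof. by rewrite linearZr_LR. Qed.

Lemma dot_suml (I : Type) (r : seq I) (P : pred I) (x : I -> H) z :
  dot (\sum_(i <- r | P i) x i) z = \sum_(i <- r | P i) dot (x i) z.
Proof. by rewrite linear_sumlz. Qed.

Lemma dotC x y : dot x y = conjC (dot y x).
Proof. by rewrite hermC expr0 mul1r. Qed.

(** The squared norm of [x - a y], for [a y] the orthogonal projection of [x]
on the line through [y], is nonnegative. *)
Lemma cauchy_schwarz x y : `|dot x y| <= `|x| * `|y|.
Proof.
have [->|y0] := eqVneq y 0; first by rewrite linear0r !normr0 mulr0.
have yy0 : 0 < dot y y by rewrite dnorm_gt0.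
pose a := dot x y / dot y y.
have : 0 <= dot (x - a *: y) (x - a *: y) by exact: dnorm_ge0.
have -> : dot (x - a *: y) (x - a *: y) = dot x x - `|dot x y| ^+ 2 / dot y y.
  have E : conjC a = conjC (dot x y) / dot y y.
    by rewrite rmorphM/= fmorphV/= -(dotC y y).
  rewrite dnormB dnormZ dotZr !normCK [conjC (_ * _)]rmorphM /= conjCK E /a.
  by have := gt_eqF yy0; move=> /negbT ?; field.
rewrite subr_ge0 ler_pdivrMr// -!dotN -exprMn.
by rewrite ler_sqr ?nnegrE ?mulr_ge0.
Qed.

Lemma normDsq x y : `|x + y| ^+ 2 = `|x| ^+ 2 + `|y| ^+ 2 + 2 * 'Re (dot x y).
Proof. by rewrite !dotN dnormD ReE; field. Qed.

Lemma normBsq x y : `|x - y| ^+ 2 = `|x| ^+ 2 + `|y| ^+ 2 - 2 * 'Re (dot x y).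
Proof. by rewrite !dotN dnormB ReE; field. Qed.

Lemma dot_injr x y : (forall z, dot z x = dot z y) -> x = y.
Proof.
move=> xy; apply/eqP; rewrite -subr_eq0 -(dnorm_eq0 dot) dotBr.
by rewrite xy subrr.
Qed.

Lemma dot_injl x y : (forall z, dot x z = dot y z) -> x = y.
Proof. by move=> xy; apply: dot_injr => z; rewrite dotC xy -dotC. Qed.

(** Expanding the quadratic form at [conj a y + x] gives
[a <T x, y> + conj a <T y, x> = 0]; the choices [a = 1] and [a = i] separate the
two terms.  This is where complex scalars matter: a rotation of the real plane
by a right angle has zero quadratic form. *)
Lemma linear_numrange0 (T : H -> H) : linear T ->
  (forall x, dot (T x) x = 0) -> forall x, T x = 0.
Proof.
move=> linT T0 x; apply: dot_injl => y; rewrite linear0l.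
have T1 a : a * dot (T x) y + conjC a * dot (T y) x = 0.
  have := T0 (conjC a *: y + x).
  rewrite linT !dotDl !dotDr !dotZl !dotZr !T0 conjCK !mulr0 add0r addr0.
  by rewrite addrC.
have Ti := T1 'i; rewrite conjCi mulNr -mulrBr in Ti.
move/eqP: Ti; rewrite mulf_eq0 (negPf (neq0Ci _)) /= subr_eq0 => /eqP e.
have := T1 1; rewrite rmorph1 !mul1r -e -mulr2n => /eqP.
by rewrite -mulr_natr mulf_eq0 pnatr_eq0 orbF => /eqP.
Qed.

End InnerProduct.

(** * The Riesz representation theorem *)

Section Riesz.
Variables (R : realType) (H : completeNormedModType R[i]).
Variable dot : {dot H for conjC}.
Hypothesis dotN : induces_norm dot.
Implicit Types (x y z h : H).

Let re (z : R[i]) : R := complex.Re z.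
Let nr (x : H) : R := re `|x|.

Let reD (u v : R[i]) : re (u + v) = re u + re v.
Proof. by case: u; case: v. Qed.

Let reN (u : R[i]) : re (- u) = - re u.
Proof. by case: u. Qed.

Let reZ (t : R) (u : R[i]) : re (t%:C%C * u) = t * re u.
Proof. by case: u => a b; rewrite /re /= mul0r subr0. Qed.

Let re_le (u v : R[i]) : u <= v -> re u <= re v.
Proof. by rewrite lecE => /andP[]. Qed.

Let re_norm (u : R[i]) : `|re u| <= re `|u|.
Proof. exact: re_le (normc_ge_Re u). Qed.

Let reK (u : R[i]) : 0 <= u -> (re u)%:C%C = u.
Proof. by move=> u0; rewrite /re RRe_real// ger0_real. Qed.

Let nrE x : (nr x)%:C%C = `|x|.
Proof. exact: reK. Qed.

Let nr_ge0 x : 0 <= nr x.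
Proof. exact: re_le (normr_ge0 x). Qed.

Let re_dotxx x : re (dot x x) = nr x ^+ 2.
Proof. by rewrite -dotN -nrE -rmorphXn. Qed.

Variable (phi : H -> R[i]).
Hypothesis phi_scalar : scalar phi.

Let phi0 : phi 0 = 0.
Proof.
have := phi_scalar (-1) 0 0; rewrite scaler0 addr0 => ->.
by rewrite mulN1r addNr.
Qed.

Let phiZ a x : phi (a *: x) = a * phi x.
Proof. by have := phi_scalar a x 0; rewrite phi0 !addr0. Qed.

(** Minimizing [q] amounts to minimizing the distance to the vector that
represents [phi], since [q x = |x - z|^2 - |z|^2] when [phi = <., z>].  [dq x h]
is half of the derivative of [q] at [x] in the direction [h]. *)
Let q x := nr x ^+ 2 - 2 * re (phi x).
Let dq x h := re (dot x h) - re (phi h).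

Let real_c (t : R) : t%:C%C \is Num.real.
Proof. by rewrite complex_real. Qed.

Let reJ (u : R[i]) : re (conjC u) = re u.
Proof. by case: u. Qed.

Let qDZ x h (t : R) :
  q (x + t%:C%C *: h) = q x + t ^+ 2 * nr h ^+ 2 + 2 * t * dq x h.
Proof.
rewrite /q /dq -!re_dotxx dnormD dnormZ dotZr (conj_Creal (real_c t)).
have -> : phi (x + t%:C%C *: h) = t%:C%C * phi h + phi x by rewrite addrC phi_scalar.
rewrite real_normK ?real_c// -rmorphXn !reD reJ !reZ; ring.
Qed.

Hypothesis phi_bounded : exists C : R, forall x, `|phi x| <= C%:C%C * `|x|.

Let q_lbound : has_lbound (range q).
Proof.
have [C phiC] := phi_bounded; exists (- C ^+ 2) => _ [x _ <-].
have : re (phi x) <= C * nr x.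
  by rewrite (le_trans (ler_norm _))// (le_trans (re_norm _))// -reZ re_le.
have := sqr_ge0 (nr x - C); rewrite /q; nra.
Qed.

Let m := inf (range q).

Let q_ge x : m <= q x.
Proof. by apply: ge_inf => //; exists x. Qed.

Let q_inf (e : R) : 0 < e -> exists x, q x < m + e.
Proof.
move=> e0; have [|_ [x _ <-] qx] := @inf_adherent _ (range q) e e0; last by exists x.
by split => //; exists (q 0), 0.
Qed.

(** The sublevel sets of [q] replace a minimizing sequence, so that none has to
be chosen. *)
Let min_filter : set_system H :=
  filter_from [set e : R | 0 < e] (fun e => [set x | q x < m + e]).

Let min_filter_proper : ProperFilter min_filter.
Proof.
apply: filter_from_proper => [|e e0]; last exact: q_inf.
apply: filter_from_filter => [|e f e0 f0]; first by exists 1 => /=.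
exists (Num.min e f); first by rewrite /= lt_min e0.
by move=> x /=; rewrite addr_minr lt_min => /andP[].
Qed.

#[local] Existing Instance min_filter_proper.

Let nr_lt x (e : R[i]) : nr x < re e -> 0 < e -> `|x| < e.
Proof. by move=> xe e0; rewrite -nrE -(reK (ltW e0)) ltcR. Qed.

(** The parallelogram identity: [|y - x|^2 / 2] is [q x + q y] minus twice the
value of [q] at the midpoint, hence is less than [2 e] when [q x] and [q y] are
within [e] of the infimum. *)
Let min_filter_cauchy : cauchy min_filter.
Proof.
apply/cauchy_exP => eps eps0.
have r0 : 0 < re eps by rewrite -ltcR reK// ltW.
have e0 : 0 < re eps ^+ 2 / 4 by rewrite divr_gt0// exprn_gt0.
have [x qx] := q_inf e0; exists x; exists (re eps ^+ 2 / 4) => // y /= qy.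
rewrite -ball_normE /= distrC; apply: nr_lt => //.
have Ey : q y = q x + nr (y - x) ^+ 2 + 2 * dq x (y - x).
  by have := qDZ x (y - x) 1; rewrite scale1r subrKC expr1n !mul1r mulr1.
have Em := qDZ x (y - x) 2^-1.
have := q_ge (x + (2^-1 : R)%:C%C *: (y - x)); rewrite Em => mq.
rewrite -ltr_sqr ?nnegrE ?nr_ge0 ?ltW//.
move: mq; rewrite exprVn; nra.
Qed.

(** Completeness gives a limit [z] of the sublevel sets, and the derivative of
[q] vanishes there.  Passing to the limit in [m <= q (x + h)], rather than in
[q] itself, requires only the continuity of [<., h>]. *)
Lemma riesz : exists z, forall x, phi x = dot x z.
Proof.
have [z Fz] : exists z, min_filter --> z.
  by apply/cvg_ex; exact: cauchy_cvg min_filter_cauchy.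
exists z.
have dq_ge h : 0 <= nr h ^+ 2 + 2 * dq z h.
  apply/ler_addgt0Pr => e e0.
  have d0 : 0 < e / (4 * (nr h + 1)).
    by rewrite divr_gt0// mulr_gt0// ltr_wpDl.
  have Fq : min_filter [set x | q x < m + e / 2].
    by exists (e / 2) => //=; rewrite divr_gt0.
  have Fb : min_filter [set x | `|z - x| < (e / (4 * (nr h + 1)))%:C%C].
    apply: (@cvgr_dist_lt _ _ _ min_filter _ id z) => //.
    by rewrite ltcR.
  have [x [/= qx xz]] := filter_ex (filterI Fq Fb).
  have := q_ge (x + 1%:C%C *: h); rewrite qDZ => mq.
  have : re (dot (x - z) h) <= e / 4.
    rewrite (le_trans (ler_norm _))// (le_trans (re_norm _))//.
    have: `|dot (x - z) h| <= (e / (4 * (nr h + 1)))%:C%C * (nr h + 1)%:C%C.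
      rewrite (le_trans (cauchy_schwarz dotN _ _))// ler_pM//.
        by rewrite distrC ltW.
      by rewrite -nrE lecR ler_wpDr.
    rewrite -rmorphM/= => /re_le /le_trans; apply.
    rewrite /re/=.
    have : nr h + 1 != 0 by rewrite gt_eqF// ltr_wpDl.
    by move=> n0; rewrite le_eqVlt; apply/orP; left; apply/eqP; field.
  rewrite dotBl reD reN; move: mq qx; rewrite /dq; nra.
have dq0 h : dq z h = 0.
  (* If the derivative were nonzero, a small step [t] against it would violate
     [dq_ge]; the [+ 1] keeps the denominator nonzero when [h = 0]. *)
  have n0 := nr_ge0 h.
  pose t := - dq z h / (nr h ^+ 2 + 1).
  have n1 : nr h ^+ 2 + 1 != 0 by rewrite gt_eqF// ltr_wpDl// sqr_ge0.
  have tE : dq z h = - t * (nr h ^+ 2 + 1) by rewrite /t; field.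
  have := dq_ge (t%:C%C *: h).
  have -> : dq z (t%:C%C *: h) = t * dq z h.
    rewrite /dq dotZr (conj_Creal (real_c t)) reZ.
    by rewrite phiZ reZ mulrBr.
  have -> : nr (t%:C%C *: h) ^+ 2 = t ^+ 2 * nr h ^+ 2.
    rewrite -!re_dotxx dnormZ real_normK ?real_c// -rmorphXn.
    by rewrite reZ.
  rewrite tE => le0.
  have : t ^+ 2 <= 0 by have := sqr_ge0 (t * nr h); nra.
  rewrite le_eqVlt ltNge sqr_ge0 orbF sqrf_eq0 => /eqP ->.
  by rewrite oppr0 mul0r.
have re_eq h : re (phi h) = re (dot h z).
  by rewrite dotC reJ; apply/esym/eqP; rewrite -subr_eq0; apply/eqP/dq0.
move=> x; apply/eqP; rewrite eq_complex; apply/andP; split; apply/eqP.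
  exact: re_eq.
(* The imaginary part of a value of [phi] at [x] is minus its real part at [i x]. *)
have := re_eq ('i%C *: x); rewrite phiZ dotZl /re.
by rewrite !(mulrC 'i%C) !ReiNIm => /oppr_inj.
Qed.
End Riesz.

(** * Unconditional sums *)

Section UnconditionalSums.
Variables (R : realType) (I : choiceType).
Implicit Types (J : set I) (A B : {fset I}).

#[global] Instance finsets_proper : ProperFilter (finsets I).
Proof.
apply: filter_from_proper => [|A _]; last by exists A => /=.
apply: filter_from_filter => [|A B _ _]; first by exists fset0.
exists (A `|` B)%fset => // C /= ABC.
by split; apply: fsubset_trans ABC; rewrite ?fsubsetUl ?fsubsetUr.
Qed.

Section NormedModule.
Variable V : normedModType R[i].
Implicit Types (x y : I -> V) (s t : V).

Lemma partial_sumD J x A B : (A `<=` B)%fset ->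
  partial_sum J x B = partial_sum J x A + partial_sum J x (B `\` A)%fset.
Proof.
move=> AB; rewrite /partial_sum -big_cat; apply: perm_big.
apply: uniq_perm => [||i]; first exact: fset_uniq.
  rewrite cat_uniq !fset_uniq/= andbT; apply/hasPn => i.
  by rewrite !inE => /andP[].
rewrite mem_cat !inE; case: (boolP (i \in A)) => //= iA.
exact: (fsubsetP AB).
Qed.

Lemma has_sumE J x s : has_sum J x s -> sum_over J x = s.
Proof. by move=> xs; apply: norm_cvg_lim. Qed.

Lemma has_sum_unique J x s t : has_sum J x s -> has_sum J x t -> s = t.
Proof. by move=> /has_sumE <- /has_sumE <-. Qed.

Lemma has_sum_lin J x y s t (a : R[i]) : has_sum J x s -> has_sum J y t ->
  has_sum J (fun i => a *: x i + y i) (a *: s + t).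
Proof.
move=> xs yt; rewrite /has_sum.
have -> : partial_sum J (fun i => a *: x i + y i) =
    (a \*: partial_sum J x) + partial_sum J y.
  apply/funext => A; rewrite /partial_sum big_split/= -scaler_sumr.
  by [].
by apply: cvgD => //; exact: cvgZl_tmp.
Qed.

Lemma has_sum_setC J x s t : has_sum J x s -> has_sum (~` J) x t ->
  has_sum [set: I] x (s + t).
Proof.
move=> xs xt; rewrite /has_sum.
have -> : partial_sum [set: I] x = partial_sum J x + partial_sum (~` J) x.
  apply/funext => A; rewrite /partial_sum.
  transitivity (\sum_(i <- A) x i); first by apply: eq_bigl => i; rewrite in_setT.
  rewrite (bigID (mem J))/=; congr (_ + _).
  by apply: eq_bigl => i; rewrite in_setC.
exact: cvgD.
Qed.

Lemma has_sum_bounded_linear (W : normedModType R[i]) J x s (g : V -> W) (C : R[i]) :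
  0 < C -> linear g -> (forall u, `|g u| <= C * `|u|) ->
  has_sum J x s -> has_sum J (g \o x) (g s).
Proof.
move=> C0 ling gC xs; rewrite /has_sum.
have gD u v : g (u + v) = g u + g v by rewrite -{1}(scale1r u) ling scale1r.
have gB u v : g (u - v) = g u - g v.
  by rewrite addrC -scaleN1r ling scaleN1r addrC.
have g0 : g 0 = 0 by rewrite -(subrr 0) gB subrr.
have gS A : partial_sum J (g \o x) A = g (partial_sum J x A).
  by rewrite /partial_sum (big_morph g gD g0).
apply/cvgrPdist_lt => e e0.
have [A _ Ae] := @cvgr_dist_lt _ _ _ _ _ _ _ xs (e / C) (divr_gt0 e0 C0).
exists A => // B /Ae lt_e; rewrite /= gS -gB.
by rewrite (le_lt_trans (gC _))// mulrC -ltr_pdivlMr.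
Qed.

End NormedModule.

(** Cauchy's criterion: the partial sums over the finite supersets of [A] all lie
within [e] of the one over [A], since they differ from it by a sum over a set
disjoint from [A]. *)
Lemma summable_cauchy (V : completeNormedModType R[i]) J (x : I -> V) :
  (forall e : R[i], 0 < e -> exists A,
     forall B, [disjoint B & A]%fset -> `|partial_sum J x B| < e) ->
  summable_over J x.
Proof.
move=> xC; apply/cvg_ex; apply: cauchy_cvg; apply/cauchy_exP => e e0.
have [A Ae] := xC e e0; exists (partial_sum J x A).
exists A => // B /= AB; rewrite -ball_normE /= distrC.
rewrite (partial_sumD _ _ AB) addrC addKr.
by apply: Ae; apply/fsetDidPl; rewrite fsetDDl fsetUid.
Qed.

Section NonnegativeTerms.
Variables (p : I -> R[i]^o) (s : R[i]^o).
Hypotheses (p0 : forall i, 0 <= p i) (s_real : s \is Num.real).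
Hypothesis ps : has_sum [set: I] p s.

Let sumE A : partial_sum [set: I] p A = \sum_(i <- A) p i.
Proof. by apply: eq_bigl => i; rewrite in_setT. Qed.

Let sum_ge0 A : 0 <= \sum_(i <- A) p i.
Proof. by rewrite sumr_ge0. Qed.

Lemma partial_sum_le A : \sum_(i <- A) p i <= s.
Proof.
apply/ler_addgt0Pr => e e0.
have [C _ Cs] := @cvgr_dist_lt _ _ _ _ _ _ _ ps e e0.
have AB := fsubsetUl A C; have := Cs (A `|` C)%fset (fsubsetUr A C).
rewrite sumE real_ltr_norml; last by rewrite realB// ger0_real.
move=> /andP[+ _]; rewrite ltrBrDl ltrBlDr => /ltW; apply: le_trans.
by rewrite -!sumE (partial_sumD _ _ AB) lerDl sumE.
Qed.

(** Since no partial sum exceeds [s], the terms outside [A] contribute at most the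
gap between [s] and the partial sum over [A]. *)
Lemma has_sum_tail (e : R[i]) : 0 < e ->
  exists A, forall B, [disjoint B & A]%fset -> \sum_(i <- B) p i < e.
Proof.
move=> e0; have [A _ Ae] := @cvgr_dist_lt _ _ _ _ _ _ _ ps e e0.
exists A => B BA; have := Ae A (fsubset_refl A).
apply: le_lt_trans; rewrite ger0_norm ?subr_ge0 sumE ?partial_sum_le//.
rewrite lerBrDl; have := partial_sum_le (A `|` B)%fset.
rewrite -!sumE (partial_sumD _ _ (fsubsetUl A B)) fsetDUl fsetDv fset0U.
by move/fsetDidPl: BA => ->.
Qed.

End NonnegativeTerms.
End UnconditionalSums.

(** * The adjoint of a bounded operator *)

Section Adjoint.
Variables (R : realType) (H : completeNormedModType R[i]).
Variable dot : {dot H for conjC}.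
Hypothesis dotN : induces_norm dot.
Variable K : {linear H -> H}.
Implicit Types (x y z : H).

(** The constant in [bounded_operator] is a complex number of unknown sign;
replacing it by its modulus plus one makes it real and positive. *)
Lemma bounded_operator_gt0 : bounded_operator K ->
  exists2 B : R, 0 < B & forall x, `|K x| <= B%:C%C * `|x|.
Proof.
move=> [M KM]; exists (complex.Re `|M| + 1) => [|x].
  by rewrite ltr_wpDl// -lecR RRe_real ?normr_real//; exact: normr_ge0.
have -> : (complex.Re `|M| + 1)%:C%C = `|M| + 1.
  by rewrite -[in RHS](RRe_real (normr_real M)) rmorphD rmorph1.
rewrite mulrDl mul1r ler_wpDr//.
have M0 : 0 <= M * `|x| by apply: le_trans (KM x).
by rewrite (le_trans (KM x))// -(ger0_norm M0) normrM normr_id.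
Qed.

Hypothesis bK : bounded_operator K.

Lemma dot_adjoint x y : dot (K x) y = dot x (adjoint dot K y).
Proof.
have [B B0 KB] := bounded_operator_gt0 bK.
have [z Kz] : exists z, forall x, dot (K x) y = dot x z.
  apply: (riesz dotN) => [a u v|]; first by rewrite linearP dotDl dotZl.
  exists (B * complex.Re `|y|) => u; 
  have -> : (B * complex.Re `|y|)%:C%C = B%:C%C * `|y|.
    by rewrite -[in RHS](RRe_real (normr_real y)) rmorphM.
  by rewrite (le_trans (cauchy_schwarz dotN _ _))// mulrAC ler_wpM2r.
have /getPex : exists z, [set z : H | forall x, dot (K x) y = dot x z] z.
  by exists z.
exact.
Qed.

Lemma adjoint_linear : linear (adjoint dot K).
Proof.
move=> a x y; apply: (dot_injr (dot := dot)) => z.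
by rewrite -dot_adjoint !dotDr !dotZr -!dot_adjoint.
Qed.

(** [|K^* x|^2 = <K K^* x, x> <= B |K^* x| |x|]. *)
Lemma adjoint_bounded :
  exists2 C : R[i], 0 < C & forall x, `|adjoint dot K x| ^+ 2 <= C * `|x| ^+ 2.
Proof.
have [B B0 KB] := bounded_operator_gt0 bK.
have BC : 0 < B%:C%C :> R[i] by rewrite ltcR.
exists (B%:C%C ^+ 2) => [|x]; first by rewrite exprn_gt0.
rewrite -exprMn ler_sqr ?nnegrE ?mulr_ge0// ?(ltW BC)//.
have [->|z0] := eqVneq (adjoint dot K x) 0.
  by rewrite normr0 mulr_ge0// ltW.
rewrite -(ler_pM2l (x := `|adjoint dot K x|)) ?normr_gt0// -expr2 dotN.
rewrite -[leLHS]ger0_norm//= mulrCA mulrA.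
rewrite -dot_adjoint (le_trans (cauchy_schwarz dotN _ _))// ler_wpM2r//.
Qed.

End Adjoint.

Lemma has_sum_dot (R : realType) (H : normedModType R[i])
    (dot : {dot H for conjC}) (I : choiceType) (J : set I) (x : I -> H) (s y : H) :
  induces_norm dot -> has_sum J x s ->
  has_sum J (fun i => dot (x i) y : R[i]^o) (dot s y : R[i]^o).
Proof.
move=> dotN.
apply: (@has_sum_bounded_linear _ _ _ R[i]^o _ _ _ (fun u => dot u y) (`|y| + 1)).
- by rewrite ltr_wpDl.
- by move=> a u v; rewrite dotDl dotZl.
- move=> u; rewrite (le_trans (cauchy_schwarz dotN _ _))// mulrC ler_wpM2r//.
  by rewrite lerDl.
Qed.

Section ParsevalKFrame.
Variables (R : realType) (H : completeNormedModType R[i]).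
Variable dot : {dot H for conjC}.
Hypothesis dotN : induces_norm dot.
Variable K : {linear H -> H}.
Hypothesis bK : bounded_operator K.
Variables (I : countType) (F : I -> H).
Hypothesis frameF : parseval_K_frame dot K F.
Implicit Types (f g : H) (J : set I) (A : {fset I}).

Let v f i := dot f (F i) *: F i.

Lemma frame_sum_le f A :
  \sum_(i <- A) `|dot f (F i)| ^+ 2 <= `|adjoint dot K f| ^+ 2.
Proof.
have p0 i : 0 <= `|dot f (F i)| ^+ 2 by rewrite exprn_ge0.
have sR : `|adjoint dot K f| ^+ 2 \is Num.real by rewrite realX ?normr_real.
exact: (partial_sum_le p0 sR (@frameF f)).
Qed.

(** [|w|^2] is the sum of [<f, F i> <F i, w>] over the index set of [w].  The
arithmetic-geometric inequality splits each term, weighted so that the part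
[sum_i |<w, F i>|^2 <= C |w|^2] coming from the frame condition is absorbed by
the left-hand side. *)
Lemma synthesis_bounded : exists2 C : R[i], 0 < C & forall f J A,
  `|partial_sum J (v f) A| ^+ 2 <= C * \sum_(i <- A) `|dot f (F i)| ^+ 2.
Proof.
have [C C0 KC] := adjoint_bounded dotN bK.
exists C => // f J A; set w := partial_sum J (v f) A.
have wE : `|w| ^+ 2 <= \sum_(i <- A) `|dot f (F i)| * `|dot w (F i)|.
  rewrite dotN -[leLHS]ger0_norm//= {1}/w /partial_sum dot_suml.
  rewrite (le_trans (ler_norm_sum _ _ _))// big_mkcond ler_sum// => i _.
  case: ifP => _; last by rewrite mulr_ge0.
  by rewrite /v dotZl normrM (dotC _ w) norm_conjC.
have wC : \sum_(i <- A) `|dot w (F i)| ^+ 2 <= C * `|w| ^+ 2.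
  by rewrite (le_trans (frame_sum_le _ _)).
have : C * `|w| ^+ 2 *+ 2 <=
    C ^+ 2 * (\sum_(i <- A) `|dot f (F i)| ^+ 2) + C * `|w| ^+ 2.
  apply: (le_trans _ (lerD (lexx _) wC)).
  apply: (@le_trans _ _ ((C * \sum_(i <- A) `|dot f (F i)| * `|dot w (F i)|) *+ 2)).
    by rewrite lerMn2r/= ler_wpM2l// ltW.
  rewrite !mulr_sumr -big_split -sumrMnl ler_sum//= => i _.
  rewrite mulrA -exprMn.
  by apply: (real_leif_mean_square_scaled _ _).1; rewrite ger0_real// mulr_ge0// ltW.
by rewrite mulr2n lerD2r expr2 -mulrA ler_pM2l.
Qed.

Lemma synthesis_summable f J : summable_over J (v f).
Proof.
have [C C0 vC] := synthesis_bounded.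
have p0 i : 0 <= `|dot f (F i)| ^+ 2 by rewrite exprn_ge0.
have sR : `|adjoint dot K f| ^+ 2 \is Num.real by rewrite realX ?normr_real.
apply: summable_cauchy => e e0.
have e2 : 0 < e ^+ 2 / C by rewrite divr_gt0// exprn_gt0.
have [A Ae] := has_sum_tail p0 sR (@frameF f) e2.
exists A => B /Ae; rewrite ltr_pdivlMr// mulrC => ltB.
rewrite -ltr_sqr ?nnegrE ?(ltW e0)//.
exact: le_lt_trans (vC f J B) ltB.
Qed.

Lemma synthesis_has_sum f J : has_sum J (v f) (sum_over J (v f)).
Proof. by have [s vs] := synthesis_summable f J; rewrite (has_sumE vs). Qed.

(** The operators on both sides are linear and have the same quadratic form
[|K^* g|^2]. *)
Lemma frame_operatorE f : sum_over [set: I] (v f) = K (adjoint dot K f).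
Proof.
pose S f := sum_over [set: I] (v f).
have linS : linear S.
  move=> a g h; apply: has_sumE.
  have -> : v (a *: g + h) = fun i => a *: v g i + v h i.
    by apply/funext => i; rewrite /v dotDl dotZl scalerDl scalerA.
  by apply: has_sum_lin; exact: synthesis_has_sum.
apply/eqP; rewrite -subr_eq0; apply/eqP.
pose T g := S g - K (adjoint dot K g).
apply: (@linear_numrange0 _ _ dot T) => [a g h|g].
  rewrite /T linS (adjoint_linear dotN bK) linearP scalerBr opprD.
  by rewrite addrACA.
rewrite /T dotBl (dot_adjoint dotN bK) -dotN; apply/eqP; rewrite subr_eq0; apply/eqP.
apply: has_sum_unique (@frameF g).
have := has_sum_dot (y := g) dotN (@synthesis_has_sum g [set: I]).
congr has_sum; apply/funext => i.
by rewrite /v dotZl (dotC dot (F i)) normCK.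
Qed.

End ParsevalKFrame.

Theorem theorem2p5 (R : realType) (H : completeNormedModType R[i])
    (dot : {dot H for conjC}) (dotN : induces_norm dot) (sepH : separable_space H)
    (K : {linear H -> H}) (bK : bounded_operator K)
    (I : countType) (F : I -> H) (frameF : parseval_K_frame dot K F) :
  forall (J : set I) (f : H),
    let KKf : H := K (adjoint dot K f) in
    let c : I -> R[i]^o := fun i => dot f (F i) * conjC (dot KKf (F i)) in
    let v : I -> H := fun i => dot f (F i) *: F i in
    [/\ summable_over J c, summable_over (~` J) c, summable_over J v & summable_over (~` J) v] /\
    'Re (sum_over (~` J) c) + `|sum_over J v| ^+ 2
      = 'Re (sum_over J c) + `|sum_over (~` J) v| ^+ 2 /\
    'Re (sum_over J c) + `|sum_over (~` J) v| ^+ 2 >= 3 / 4 * `|KKf| ^+ 2.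
Proof.
move=> J f KKf c v.
have vJ J' : has_sum J' v (sum_over J' v) by exact: (synthesis_has_sum dotN bK frameF).
have cJ J' : has_sum J' c (dot (sum_over J' v) KKf : R[i]^o).
  have := has_sum_dot (y := KKf) dotN (vJ J').
  by congr has_sum; apply/funext => i; rewrite /v dotZl (dotC dot (F i)).
split; first by split; [exists (dot (sum_over J v) KKf) | exists (dot (sum_over (~` J) v) KKf)
  | exists (sum_over J v) | exists (sum_over (~` J) v)].
have KKfE : KKf = sum_over J v + sum_over (~` J) v.
  rewrite -[LHS](frame_operatorE dotN bK frameF).
  by apply: has_sumE; exact: has_sum_setC (@vJ J) (@vJ (~` J)).
rewrite (has_sumE (cJ J)) (has_sumE (cJ (~` J))) KKfE.
set a := sum_over J v; set b := sum_over (~` J) v.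
have reC : 'Re (dot b a) = 'Re (dot a b) by rewrite (dotC dot b) Re_conj.
have re2 x : 'Re (dot x x) = `|x| ^+ 2.
  by rewrite -dotN; apply/Creal_ReP; rewrite realX ?normr_real.
rewrite !dotDr !raddfD /= !re2 reC (normDsq dotN); split; first by ring.
rewrite -subr_ge0.
have -> : `|a| ^+ 2 + 'Re (dot a b) + `|b| ^+ 2
    - 3 / 4 * (`|a| ^+ 2 + `|b| ^+ 2 + 2 * 'Re (dot a b)) = `|a - b| ^+ 2 / 4.
  by rewrite (normBsq dotN); field.
by rewrite divr_ge0 ?exprn_ge0.
Qed.
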